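(* Let $\alpha>0$ and let the surrogate be linear in its parameters, $u(\theta,\boldsymbol y)=B(\boldsymbol y)\theta$ with $\theta\in\mathbb R^d$ and $B(\boldsymbol y):\mathbb R^d\to V$ linear, and suppose $\sigma_{\min}(\mathbb E_{\boldsymbol y}[B(\boldsymbol y)^\ast B(\boldsymbol y)])>0$. Then the functions $$f(x,\boldsymbol y)=\tfrac12\|\mathcal QB(\boldsymbol y)\theta-u_0\|_{\mathfrak J}^2+\tfrac\alpha2\|z\|_{\mathcal Z}^2,\qquad g(x,\boldsymbol y)=\|A(\boldsymbol y)B(\boldsymbol y)\theta-\mathcal Bz\|_{W'}^2,\qquad x=(z,\theta)\in\mathcal X,$$ satisfy the structural assumptions for convergence of the penalized stochastic gradient method, i.e.: for $\bar\lambda>0$, a sequence of penalty parameters $\lambda_k>0$ such that $|\lambda_k-\bar\lambda|^2$ is monotonically decreasing, and $x^\ast\in\arg\min_{x\in\mathcal X}\Psi_{\bar\lambda}(x)$, where $\Psi_{\bar\lambda}(x)=\mathbb E_{\boldsymbol y}[f(x,\boldsymbol y)+\bar\lambda g(x,\boldsymbol y)]$, (i) there is $c>0$ such that $\langle x-x^\ast,\nabla_x\Psi_{\bar\lambda}(x)\rangle_{\mathcal X}\ge c\|x-x^\ast\|_{\mathcal X}^2$ for all $x\in\mathcal X$; (ii) there are monotonically increasing, bounded sequences $(a_k)$, $(b_k)$ with $a_0,b_0>0$ such that for each $k$ and all $x\in\mathcal X$, $\mathbb E_{\boldsymbol y}[\|\nabla_x[f(x,\boldsymbol y)+\lambda_kg(x,\boldsymbol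 y)]\|_{\mathcal X}^2]<a_k+b_k\|x-x^\ast\|_{\mathcal X}^2$; (iii) for every $R>0$ there is $\kappa_1(R)>0$ such that for each $k$, $\sup_{x\in\mathcal X,\ \|x\|_{\mathcal X}\le R}\|\mathbb E_{\boldsymbol y}[(\lambda_k-\bar\lambda)\nabla_xg(x,\boldsymbol y)]\|_{\mathcal X}^2\le\kappa_1(R)|\lambda_k-\bar\lambda|^2$.
   Context: $U$ is a compact Hausdorff parameter domain with probability measure $\mu$; $\mathbb E_{\boldsymbol y}$ is expectation over $\boldsymbol y\sim\mu$. $V,W',\mathcal Z,\mathfrak J$ are Hilbert spaces; $A(\boldsymbol y)\in\mathcal L(V,W')$ is continuous in $\boldsymbol y$ and boundedly invertible with $\|A(\boldsymbol y)\|\le a_{\max}$ and $\|A(\boldsymbol y)^{-1}\|\le1/a_{\min}$ for all $\boldsymbol y\in U$; $\mathcal B\in\mathcal L(\mathcal Z,W')$ and $\mathcal Q\in\mathcal L(V,\mathfrak J)$ have bounded inverses; $u_0\in\mathfrak J$. $\mathcal X=\mathcal Z\times\mathbb R^d$ with the product Hilbert norm. $^\ast$ denotes the Hilbert space adjoint, and $\sigma_{\min}$ the smallest eigenvalue. Convention: all expectations written are assumed to exist and be finite. *)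

(* Defs.v *)
From HB Require Import structures.
From mathcomp Require Import all_boot all_order all_algebra.
From mathcomp Require Import all_classical all_reals all_analysis.
From mathcomp Require Import ring lra.

Set Implicit Arguments.
Unset Strict Implicit.
Unset Printing Implicit Defensive.

Import Order.TTheory GRing.Theory Num.Theory.
Import numFieldNormedType.Exports.

Local Open Scope classical_set_scope.
Local Open Scope ring_scope.

HB.mixin Record NormedModule_hasInner (R : realType) V & NormedModule R V := {
  inner : V -> V -> R;
  innerC : forall u v, inner u v = inner v u;
  innerP : forall a u v w, inner (a *: u + v) w = a * inner u w + inner v w;
  inner_normE : forall u, `|u| ^+ 2 = inner u u
}.

#[short(type="innerModType")]
HB.structure Definition InnerModule (R : realType) :=
  {V of NormedModule R V & NormedModule_hasInner R V}.

#[short(type="hilbertType")]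
HB.structure Definition Hilbert (R : realType) :=
  {V of InnerModule R V & Complete V}.

HB.factory Record Lmodule_hasInner (R : realType) V & GRing.Lmodule R V := {
  inner : V -> V -> R;
  innerC : forall u v, inner u v = inner v u;
  innerP : forall a u v w, inner (a *: u + v) w = a * inner u w + inner v w;
  inner_ge0 : forall u, 0 <= inner u u;
  inner_eq0 : forall u, inner u u = 0 -> u = 0
}.

HB.builders Context R V & Lmodule_hasInner R V.

Let inner0l v : inner 0 v = 0.
Proof. by have := innerP 1 0 0 v; rewrite scaler0 addr0; lra. Qed.

Let innerZl a u v : inner (a *: u) v = a * inner u v.
Proof. by have := innerP a u 0 v; rewrite addr0 inner0l addr0. Qed.

Let innerDl u v w : inner (u + v) w = inner u w + inner v w.
Proof. by have := innerP 1 u v w; rewrite scale1r mul1r. Qed.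

Let norm u := Num.sqrt (inner u u).

Let norm_sqr u : norm u ^+ 2 = inner u u.
Proof. by rewrite sqr_sqrtr ?inner_ge0. Qed.

Let norm_ge0 u : 0 <= norm u.
Proof. exact: sqrtr_ge0. Qed.

Let inner_comb a b u v : inner (a *: u + b *: v) (a *: u + b *: v) =
  a ^+ 2 * norm u ^+ 2 + 2 * a * b * inner u v + b ^+ 2 * norm v ^+ 2.
Proof.
rewrite !norm_sqr innerP innerZl (innerC u) (innerC v) !innerP !innerZl.
by rewrite (innerC v u); ring.
Qed.

Let norm_eq0 u : norm u = 0 -> u = 0.
Proof.
by move=> u0; apply: inner_eq0; rewrite -norm_sqr u0 expr0n.
Qed.

Let CauchySchwarz u v : inner u v <= norm u * norm v.
Proof.
have [->|u0] := eqVneq u 0; first by rewrite inner0l mulr_ge0.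
have [->|v0] := eqVneq v 0; first by rewrite innerC inner0l mulr_ge0.
have un : 0 < norm u.
  by rewrite lt_def norm_ge0 andbT; apply: contra_neq u0; exact: norm_eq0.
have vn : 0 < norm v.
  by rewrite lt_def norm_ge0 andbT; apply: contra_neq v0; exact: norm_eq0.
have := inner_ge0 (norm v *: u + (- norm u) *: v); rewrite inner_comb => h.
have {}h : 0 <= (norm u * norm v) * (norm u * norm v - inner u v) by nra.
by rewrite pmulr_rge0 ?mulr_gt0// subr_ge0 in h.
Qed.

Let ler_normD u v : norm (u + v) <= norm u + norm v.
Proof.
rewrite -(ler_pXn2r (n := 2)) ?nnegrE ?addr_ge0//.
rewrite [leLHS]norm_sqr; have := inner_comb 1 1 u v; rewrite !scale1r => ->.
by have := CauchySchwarz u v; nra.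
Qed.

Let normrZ (l : R) u : norm (l *: u) = `|l| * norm u.
Proof.
by rewrite /norm innerZl innerC innerZl mulrA -expr2 sqrtrM ?sqr_ge0// sqrtr_sqr.
Qed.

HB.instance Definition _ := Lmodule_isNormed.Build R V ler_normD normrZ norm_eq0.

HB.instance Definition _ :=
  NormedModule_hasInner.Build R V innerC innerP norm_sqr.

HB.end.

(* R^d with the Euclidean norm; MathComp-Analysis norms 'rV[R]_d by the maximum *)
Definition euclid (R : realType) (d : nat) : Type := 'rV[R]_d.

Section euclid.
Context {R : realType} {d : nat}.

HB.instance Definition _ := GRing.Lmodule.on (euclid R d).

Definition euclid_inner (u v : euclid R d) : R := \sum_(i < d) u ord0 i * v ord0 i.

Let euclid_innerC u v : euclid_inner u v = euclid_inner v u.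
Proof. by apply: eq_bigr => i _; rewrite mulrC. Qed.

Let euclid_innerP a u v w :
  euclid_inner (a *: u + v) w = a * euclid_inner u w + euclid_inner v w.
Proof.
rewrite /euclid_inner mulr_sumr -big_split; apply: eq_bigr => i _ /=.
by rewrite !mxE mulrDl mulrA.
Qed.

Let euclid_inner_ge0 u : 0 <= euclid_inner u u.
Proof. by apply: sumr_ge0 => i _; rewrite -expr2 sqr_ge0. Qed.

Let euclid_inner_eq0 u : euclid_inner u u = 0 -> u = 0.
Proof.
move=> /eqP; rewrite psumr_eq0 => [/allP u0|i _]; last by rewrite -expr2 sqr_ge0.
apply/rowP => i; rewrite mxE; apply/eqP.
by have := u0 i (mem_index_enum _); rewrite /= -expr2 sqrf_eq0.
Qed.

HB.instance Definition _ := Lmodule_hasInner.Build R (euclid R d)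
  euclid_innerC euclid_innerP euclid_inner_ge0 euclid_inner_eq0.


Let euclid_coord_le (u : euclid R d) i : `|u ord0 i| <= `|u|.
Proof.
rewrite -(ler_pXn2r (n := 2)) ?nnegrE// inner_normE real_normK ?num_real//.
rewrite [leRHS](bigD1 i)//= -expr2 lerDl sumr_ge0// => j _.
by rewrite -expr2 sqr_ge0.
Qed.

Let euclid_norm_le (u : euclid R d) : `|u| <= \sum_(i < d) `|u ord0 i|.
Proof.
rewrite [u in leLHS](row_sum_delta u); apply: (le_trans (ler_norm_sum _ _ _)).
apply: ler_sum => i _; rewrite normrZ ler_piMr//.
rewrite -(ler_pXn2r (n := 2)) ?nnegrE// inner_normE expr1n.
rewrite [leLHS](bigD1 i)//= big1 => [|j ji].
  by rewrite !mxE !eqxx mulr1 addr0.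
by rewrite !mxE (negbTE ji) andbF mulr0.
Qed.

Let euclid_complete (F : set_system (euclid R d)) :
  ProperFilter F -> cauchy F -> cvg F.
Proof.
move=> FF /cauchy_ballP F_cauchy.
have cvg_coord (i : 'I_d) : cvg ((fun u : euclid R d => u ord0 i) @ F).
  apply: cauchy_cvg; apply/cauchy_ballP => e e0.
  have [[A B]/= [FA FB] AB] := F_cauchy e e0.
  exists ((fun u : euclid R d => u ord0 i) @` A,
          (fun u : euclid R d => u ord0 i) @` B) => /=.
    by split; [apply: filterS FA|apply: filterS FB] => u ?; exists u.
  move=> [_ _] /= [[u Au <-] [v Bv <-]]; have := AB (u, v) (conj Au Bv).
  rewrite -!ball_normE /= => /(le_lt_trans _); apply.
  by have := euclid_coord_le (u - v) i; rewrite !mxE.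
pose l : euclid R d := \row_i lim ((fun u : euclid R d => u ord0 i) @ F).
apply/cvg_ex; exists l; apply/cvgrPdist_le => e e0.
have d0 : 0 < e / d.+1%:R by rewrite divr_gt0.
have near_coord : \forall u \near F,
    forall i : 'I_d, `|(l - u : euclid R d) ord0 i| <= e / d.+1%:R.
  apply: filter_forall => i; have /cvgrPdist_le/(_ _ d0) := cvg_coord i.
  by apply: filterS => u; rewrite !mxE.
apply: filterS near_coord => u lu; apply: (le_trans (euclid_norm_le _)).
apply: (@le_trans _ _ (\sum_(i < d) e / d.+1%:R)); first exact: ler_sum.
rewrite sumr_const card_ord -[leLHS]mulr_natr mulrAC ler_pdivrMr//.
by rewrite ler_pM2l// ler_nat.
Qed.

HB.instance Definition _ := Uniform_isComplete.Build (euclid R d) euclid_complete.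

End euclid.

(* V x W with `|(v, w)|^2 = `|v|^2 + `|w|^2; MathComp-Analysis norms V * W by
   the maximum *)
Definition hprod (R : realType) (V W : hilbertType R) : Type := (V * W)%type.

Section hprod.
Context {R : realType} {V W : hilbertType R}.

HB.instance Definition _ := GRing.Lmodule.copy (hprod V W) (V * W)%type.

Definition hprod_inner (u v : hprod V W) : R := inner u.1 v.1 + inner u.2 v.2.

Let hprod_innerC u v : hprod_inner u v = hprod_inner v u.
Proof. by rewrite /hprod_inner innerC (innerC u.2). Qed.

Let hprod_innerP a u v w :
  hprod_inner (a *: u + v) w = a * hprod_inner u w + hprod_inner v w.
Proof. by rewrite /hprod_inner /= !innerP mulrDr addrACA. Qed.

Let hprod_inner_ge0 u : 0 <= hprod_inner u u.
Proof. by rewrite /hprod_inner -!inner_normE addr_ge0 ?sqr_ge0. Qed.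

Let hprod_inner_eq0 u : hprod_inner u u = 0 -> u = 0.
Proof.
case: u => v w; rewrite /hprod_inner -!inner_normE /= => /eqP.
rewrite paddr_eq0 ?sqr_ge0// !sqrf_eq0 !normr_eq0.
by move=> /andP[/eqP-> /eqP->].
Qed.

HB.instance Definition _ := Lmodule_hasInner.Build R (hprod V W)
  hprod_innerC hprod_innerP hprod_inner_ge0 hprod_inner_eq0.

Let hprod_normE (u : hprod V W) : `|u| ^+ 2 = `|u.1| ^+ 2 + `|u.2| ^+ 2.
Proof. by rewrite !inner_normE. Qed.

Let hprod_fst_le (u : hprod V W) : `|u.1| <= `|u|.
Proof.
by rewrite -(ler_pXn2r (n := 2)) ?nnegrE// hprod_normE lerDl sqr_ge0.
Qed.

Let hprod_snd_le (u : hprod V W) : `|u.2| <= `|u|.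
Proof.
by rewrite -(ler_pXn2r (n := 2)) ?nnegrE// hprod_normE lerDr sqr_ge0.
Qed.

Let hprod_norm_le (u : hprod V W) : `|u| <= `|u.1| + `|u.2|.
Proof.
rewrite -(ler_pXn2r (n := 2)) ?nnegrE ?addr_ge0// hprod_normE.
by have := mulr_ge0 (normr_ge0 u.1) (normr_ge0 u.2); nra.
Qed.

Let hprod_complete (F : set_system (hprod V W)) :
  ProperFilter F -> cauchy F -> cvg F.
Proof.
move=> FF /cauchy_ballP F_cauchy.
have cvg_proj (T : hilbertType R) (p : hprod V W -> T) :
    (forall u v, `|p u - p v| <= `|u - v|) -> cvg (p @ F).
  move=> p_le; apply: cauchy_cvg; apply/cauchy_ballP => e e0.
  have [[A B]/= [FA FB] AB] := F_cauchy e e0.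
  exists (p @` A, p @` B) => /=.
    by split; [apply: filterS FA|apply: filterS FB] => u ?; exists u.
  move=> [_ _] /= [[u Au <-] [v Bv <-]]; have := AB (u, v) (conj Au Bv).
  rewrite -!ball_normE /= => /(le_lt_trans _); exact.
have /cvg_ex[v Fv] : cvg (fst @ F : set_system V).
  by apply: cvg_proj => u v; exact: hprod_fst_le (u - v).
have /cvg_ex[w Fw] : cvg (snd @ F : set_system W).
  by apply: cvg_proj => u w; exact: hprod_snd_le (u - w).
apply/cvg_ex; exists (v, w); apply/cvgrPdist_le => e e0.
have e20 : 0 < e / 2 by rewrite divr_gt0.
move/cvgrPdist_le : Fv => /(_ _ e20) Fv; move/cvgrPdist_le : Fw => /(_ _ e20) Fw.
near=> u; apply: (le_trans (hprod_norm_le _)); rewrite [leRHS]splitr lerD//=.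
  by near: u.
by near: u.
Unshelve. all: by end_near. Qed.

HB.instance Definition _ := Uniform_isComplete.Build (hprod V W) hprod_complete.

End hprod.

Section operators.
Context {R : realType}.

Definition opnorm (V W : normedModType R) (T : V -> W) : R :=
  sup [set `|T v| | v in [set v | `|v| <= 1]].

Definition bounded_inverse (V W : normedModType R) (T : V -> W)
    (S : {linear W -> V}) : Prop :=
  [/\ cancel T S, cancel S T & continuous S].

(* meaningful when T is linear and continuous *)
Definition adjoint (V W : hilbertType R) (T : V -> W) (w : W) : V :=
  get [set v | forall u, inner (T u) w = inner u v].

(* the Riesz representative of the Frechet derivative; meaningful when F is
   differentiable at x *)
Definition gradient (H : hilbertType R) (F : H -> R) (x : H) : H :=
  get [set v | forall h, 'd F x h = inner v h].

(* the smallest eigenvalue if M is symmetric and d > 0; it is 0 if d = 0 *)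
Definition sigma_min (d : nat) (M : 'M[R]_d) : R :=
  inf [set a | eigenvalue M a].

End operators.

Definition borel_space (U : ptopologicalType) := g_sigma_algebraType (@open U).

Section bochner.
Context {R : realType} {dT : measure_display} {T : measurableType dT}.
Context {H : hilbertType R} (mu : probability T R).

Definition simple_integral (s : {fimfun T >-> H}) : H :=
  \sum_(h \in range s) fine (mu (s @^-1` [set h])) *: h.

(* F is a pointwise limit of measurable simple functions that also converge to
   F in mean; v is the limit of their integrals *)
Definition has_bochner_integral (F : T -> H) (v : H) : Prop :=
  exists s : nat -> {fimfun T >-> H},
    [/\ forall n h, measurable (s n @^-1` [set h]),
        forall y, s n y @[n --> \oo] --> F y,
        (\int[mu]_y `|F y - s n y|%:E)%E @[n --> \oo] --> 0%E &
        simple_integral (s n) @[n --> \oo] --> v].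

Definition bochner_integrable (F : T -> H) : Prop :=
  exists v, has_bochner_integral F v.

Definition bochner_integral (F : T -> H) : H :=
  get (has_bochner_integral F).

End bochner.

Section model.
Context {R : realType} {U : ptopologicalType} {V W Z J : hilbertType R}.
Context {d : nat} (mu : probability (borel_space U) R).
Context (B : U -> {linear euclid R d -> V}).

(* matrix of B(y)^* B(y) in the canonical basis of R^d *)
Definition gram (y : U) : 'M[R]_d :=
  lin1_mx (fun t : 'rV[R]_d => adjoint (B y) (B y t) : 'rV[R]_d).

Definition expected_gram : 'M[R]_d :=
  \matrix_(i, j) fine 'E_mu[fun y => gram y i j].

Definition cost (Q : V -> J) (u0 : J) (alpha : R)
    (x : hprod Z (euclid R d)) (y : U) : R :=
  2^-1 * `|Q (B y x.2) - u0| ^+ 2 + alpha / 2 * `|x.1| ^+ 2.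

Definition residual (A : U -> {linear V -> W}) (calB : Z -> W)
    (x : hprod Z (euclid R d)) (y : U) : R :=
  `|A y (B y x.2) - calB x.1| ^+ 2.

End model.

Definition penalized (R : realType) (X : Type) (U : Type) (f g : X -> U -> R)
  (lambda : R) (x : X) (y : U) : R := f x y + lambda * g x y.

Definition expected_penalized (R : realType) (X : Type) (U : ptopologicalType)
    (mu : probability (borel_space U) R) (f g : X -> U -> R)
    (lambda : R) (x : X) : R :=
  fine 'E_mu[penalized f g lambda x].

(* Main.v *)
From HB Require Import structures.
Require Import Defs.
From mathcomp Require Import all_boot all_order all_algebra.
From mathcomp Require Import all_classical all_reals all_analysis.
From mathcomp Require Import measurable_realfun finmap ring lra.

(** Fix a sample y and write x = (z, t). Every function in play is a weighted
    sum s f + l g, which is an exact quadratic polynomial in x: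
    F (x + h) = F x + L_x h + q h, where L_x is linear and q >= 0 is homogeneous
    of degree two. By the Riesz theorem (riesz) such a function is
    differentiable with gradient representing L_x (gradient_expansion), so all
    gradients can be handled by duality, without adjoints of A, B and Q.

    The dependence on y is controlled by the squared Hilbert-Schmidt norm S(y)
    of B(y), the trace of its Gram matrix: |B(y) t|^2 <= S(y) |t|^2, hence
    |grad (s f + l g)| <= 4 M^2 (s + l) (1 + S(y)) (1 + |x|), where M bounds the
    operators and the data (objective_gradient_le). The entries of the Gram
    matrix are integrable, so S is integrable, which makes Psi a continuous
    quadratic polynomial.

    (i) The quadratic part of Psi dominates E |B t|^2 and |z|^2, since Q is
    bounded below, and E |B t|^2 is the quadratic form of the expected Gram
    matrix. That form is coercive: the matrix is positive semidefinite, and it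
    is invertible because its smallest eigenvalue is positive
    (sigma_min_coercive). At a minimiser xs the linear part is nonnegative in
    every direction, so <h, grad Psi (xs + h)> >= 2 q(h) >= c |h|^2.

    (ii) The gradient bound involves the second moment of S. It is finite because
    testing the gradient at one weight, lambda_0, on the coordinate directions
    recovers S (hs_sqr_le_gradient), and the expected squared norm of that
    gradient is finite. As |lambda_k - lambda_bar| decreases, lambda_k is
    bounded, so constant sequences a and b suffice.

    (iii) A Bochner integral is bounded in norm by the integral of any integrable
    majorant (bochner_integral_norm_le); the gradient bound provides one. *)

Set Implicit Arguments.
Unset Strict Implicit.
Unset Printing Implicit Defensive.

Import Order.TTheory GRing.Theory Num.Theory.
Import numFieldNormedType.Exports.

Local Open Scope classical_set_scope.
Local Open Scope ring_scope.

(** * Inner products and the Riesz representation theorem *)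

Section inner_product.
Context {R : realType} {H : hilbertType R}.
Implicit Types u v w : H.

Lemma innerDl u v w : inner (u + v) w = inner u w + inner v w.
Proof. by have := innerP 1 u v w; rewrite scale1r mul1r. Qed.

Lemma inner0l w : inner 0 w = 0.
Proof. by have := innerP 1 0 0 w; rewrite scaler0 addr0 mul1r; lra. Qed.

Lemma innerZl a u w : inner (a *: u) w = a * inner u w.
Proof. by have := innerP a u 0 w; rewrite addr0 inner0l addr0. Qed.

Lemma innerNl u w : inner (- u) w = - inner u w.
Proof. by rewrite -scaleN1r innerZl mulN1r. Qed.

Lemma innerBl u v w : inner (u - v) w = inner u w - inner v w.
Proof. by rewrite innerDl innerNl. Qed.

Lemma innerDr w u v : inner w (u + v) = inner w u + inner w v.
Proof. by rewrite innerC innerDl !(innerC w). Qed.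

Lemma innerZr w a u : inner w (a *: u) = a * inner w u.
Proof. by rewrite innerC innerZl (innerC w). Qed.

Lemma inner_suml (I : Type) (s : seq I) (P : pred I) (E : I -> H) w :
  inner (\sum_(i <- s | P i) E i) w = \sum_(i <- s | P i) inner (E i) w.
Proof. by apply: (big_morph (inner^~ w)) => [u v|]; rewrite ?innerDl ?inner0l. Qed.

Lemma normr_sqrD u v :
  `|u + v| ^+ 2 = `|u| ^+ 2 + 2 * inner u v + `|v| ^+ 2.
Proof. by rewrite !inner_normE innerDl !innerDr (innerC v u); ring. Qed.

Lemma inner_le_norm u v : inner u v <= `|u| * `|v|.
Proof.
have [->|u0] := eqVneq u 0; first by rewrite inner0l mulr_ge0.
have [->|v0] := eqVneq v 0; first by rewrite innerC inner0l mulr_ge0.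
have un : 0 < `|u| by rewrite normr_gt0.
have vn : 0 < `|v| by rewrite normr_gt0.
have := sqr_ge0 `| `|v| *: u + (- `|u|) *: v |; rewrite normr_sqrD !normrZ.
rewrite normrN !normr_id innerZl innerZr => h.
have {}h : 0 <= (`|u| * `|v|) * (`|u| * `|v| - inner u v) by nra.
by rewrite pmulr_rge0 ?mulr_gt0// subr_ge0 in h.
Qed.

Lemma normr_inner_le u v : `|inner u v| <= `|u| * `|v|.
Proof.
by rewrite ler_norml inner_le_norm andbT lerNl -innerNl -(normrN u) inner_le_norm.
Qed.

(** A vector is bounded by any bound on the functional that it represents. *)
Lemma normr_le_dual v M : 0 <= M -> (forall h, inner v h <= M * `|h|) ->
  `|v| <= M.
Proof.
move=> M0 /(_ v); have [->|v0] := eqVneq v 0; first by rewrite normr0.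
by rewrite -inner_normE expr2 ler_pM2r ?normr_gt0.
Qed.

(** Riesz representation: the representing vector is the minimiser of
    v |-> |v|^2 / 2 - L v; a minimising sequence is Cauchy by the parallelogram
    identity. *)
Lemma riesz (L : H -> R) (C : R) :
  (forall a u v, L (a *: u + v) = a * L u + L v) ->
  (forall v, `|L v| <= C * `|v|) -> exists v, forall h, inner v h = L h.
Proof.
move=> Llin Lbnd.
have LD u v : L (u + v) = L u + L v by have := Llin 1 u v; rewrite scale1r mul1r.
have L0 : L 0 = 0 by have := LD 0 0; rewrite addr0; lra.
have LZ a u : L (a *: u) = a * L u by have := Llin a u 0; rewrite addr0 L0 addr0.
pose F v : R := 2^-1 * `|v| ^+ 2 - L v.
pose S := range F.
have S0 : S !=set0 by exists (F 0), 0.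
have Slb : has_inf S.
  split=> //; exists (- (C ^+ 2 / 2)) => _ [v _ <-]; rewrite /F.
  have := Lbnd v; have := sqr_ge0 (`|v| - C); rewrite ler_norml => ? /andP[_ ?].
  nra.
pose m := inf S.
have mF v : m <= F v by apply: ge_inf; [exact: Slb.2|exists v].
have FD v h : F (v + h) = F v + (inner v h - L h) + 2^-1 * `|h| ^+ 2.
  by rewrite /F normr_sqrD LD; field.
have par u v : `|u - v| ^+ 2 <= 4 * (F u - m) + 4 * (F v - m).
  have [h ->] : exists h, u = v + 2 *: h.
    by exists (2^-1 *: (u - v)); rewrite scalerA divff// scale1r addrC subrK.
  have := mF (v + h); rewrite [in `|_|](addrC v) addrK !FD innerZr LZ.
  rewrite !normrZ !exprMn.
  rewrite real_normK ?num_real//; move: (inner v h) (L h) => a b; lra.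
have /boolp.choice[s sP] n : exists v, F v < m + n.+1%:R^-1.
  have n0 : 0 < n.+1%:R^-1 :> R by rewrite invr_gt0.
  by have [_ [v _ <-] vm] := inf_adherent n0 Slb; exists v.
have s_cauchy : cauchy (s @ \oo).
  apply/cauchy_ballP => e e0.
  have e8 : 0 < e ^+ 2 / 8 by rewrite divr_gt0// exprn_gt0.
  have [N NP] : exists N, N.+1%:R^-1 < e ^+ 2 / 8.
    have [N _ /(_ N (leqnn N))] := near_infty_natSinv_lt (PosNum e8).
    by exists N.
  pose D := s @` [set n | (N <= n)%N].
  have DN : (s @ \oo) D by exists N => //= n Nn; exists n.
  exists (D, D) => //= -[_ _] [[i Ni <-] [j Nj <-]] /=.
  rewrite -ball_normE /= -(ltr_pXn2r (n := 2)) ?nnegrE// ?(ltW e0)//.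
  apply: (le_lt_trans (par _ _)).
  have bnd k : (N <= k)%N -> F (s k) - m < e ^+ 2 / 8.
    move=> Nk; rewrite ltrBlDl; apply: (lt_trans (sP k)); rewrite ltrD2l.
    apply: le_lt_trans NP; rewrite lef_pV2 ?posrE ?ltr0n// ler_nat//.
  have := bnd _ Ni; have := bnd _ Nj; lra.
have /cvg_ex[v sv] : cvg (s @ \oo) by exact: cauchy_cvg.
have Fvm : F v = m.
  apply/eqP; rewrite eq_le mF andbT; apply/ler_addgt0Pr => e e0.
  pose K := `|v| + `|C| + 2.
  have K0 : 0 < K by rewrite /K ltr_wpDl// addr_ge0.
  have Fclose u : `|u - v| <= 1 -> F v <= F u + K * `|u - v|.
    move=> uv1; have := FD u (v - u); rewrite subrKC => ->.
    have := inner_le_norm u (v - u); have := Lbnd (v - u).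
    rewrite (distrC v) -addrA lerD2l ler_norml => /andP[L1 _] i1.
    have C1 : C * `|u - v| <= `|C| * `|u - v| by rewrite ler_wpM2r// ler_norm.
    have t2 : `|u - v| ^+ 2 <= `|u - v| by rewrite expr2 ler_piMl.
    have u1 : `|u| <= `|v| + 1.
      have := ler_normD v (u - v); rewrite subrKC => /le_trans->//.
      by rewrite lerD2l.
    have {}u1 : `|u| * `|u - v| <= (`|v| + 1) * `|u - v| by rewrite ler_wpM2r.
    by have := normr_ge0 (u - v); rewrite /K; lra.
  have d0 : 0 < Num.min 1 (e / 2 / K) by rewrite lt_min ltr01/= !divr_gt0.
  have /cvgrPdist_lt/(_ _ d0)[N _ NP] := sv.
  have e20 : 0 < e / 2 by rewrite divr_gt0.
  have [M _ MP] := near_infty_natSinv_lt (PosNum e20).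
  pose n := maxn N M.
  have := NP n (leq_maxl _ _); rewrite /= distrC lt_min => /andP[n1 n2].
  have n3 : n.+1%:R^-1 < e / 2 := MP n (leq_maxr _ _).
  have := Fclose (s n) (ltW n1) => n4; have := sP n => n5.
  move: n2; rewrite ltr_pdivlMr// mulrC => n2.
  rewrite (le_trans n4)// [e]splitr addrA lerD ?(ltW n2)//.
  by rewrite (le_trans (ltW n5))// lerD2l ltW.
exists v => h; apply/eqP; rewrite -subr_eq0; apply/eqP.
(* the derivative at the minimiser v in the direction h vanishes *)
set a := inner v h - L h.
have Ft t : 0 <= t * a + t ^+ 2 * (2^-1 * `|h| ^+ 2).
  have := mF (v + t *: h); rewrite FD Fvm LZ innerZr normrZ exprMn.
  rewrite real_normK ?num_real// /a; lra.
have h2 := sqr_ge0 `|h|.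
set b := 2^-1 * `|h| ^+ 2 in Ft.
have b0 : 0 <= b by rewrite mulr_ge0.
(* a step t that would make the right-hand side of Ft negative if a != 0 *)
have := Ft (- a / (b + 1)).
have b1 : 0 < b + 1 by lra.
have -> : - a / (b + 1) * a + (- a / (b + 1)) ^+ 2 * b = - (a / (b + 1)) ^+ 2.
  by field; rewrite gt_eqF.
rewrite oppr_ge0 => ab; have : (a / (b + 1)) ^+ 2 == 0 by rewrite eq_le ab sqr_ge0.
by rewrite sqrf_eq0 mulf_eq0 invr_eq0 (gt_eqF b1) orbF => /eqP.
Qed.

End inner_product.

(** * Gradients of functions with a quadratic remainder *)

Section gradient.
Context {R : realType} {H : hilbertType R}.

(** The continuous linear functional h |-> <v, h>. *)
Definition inner_with (v : H) : H -> R := inner v.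

Lemma inner_with_linear v : linear (inner_with v : H -> R^o).
Proof. by move=> a x y; rewrite /inner_with innerDr innerZr. Qed.

HB.instance Definition _ v :=
  GRing.isLinear.Build R H R^o _ (inner_with v) (inner_with_linear v).

Lemma inner_with_continuous v : continuous (inner_with v : H -> R).
Proof.
apply/linear_bounded_continuous/linear_boundedP; near=> r => x.
apply: (le_trans (normr_inner_le v x)); apply: ler_wpM2r => //.
Unshelve. all: by end_near. Qed.

(** A function that differs from an affine function by at most C2 |h|^2 is
    differentiable, and its gradient represents the linear part. *)
Lemma gradient_expansion (F L : H -> R) (x : H) (C1 C2 : R) :
  (forall a u v, L (a *: u + v) = a * L u + L v) ->
  (forall v, `|L v| <= C1 * `|v|) ->
  (forall h, `|F (x + h) - F x - L h| <= C2 * `|h| ^+ 2) ->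
  differentiable F x /\ forall h, inner (gradient F x) h = L h.
Proof.
move=> Llin L_le F_le; have [v vL] := riesz Llin L_le.
have Fo : F \o shift x = cst (F x) + (inner_with v : H -> R) +o_ 0 id.
  apply/eqaddoP => e e0.
  have C0 : 0 < `|C2| + 1 by rewrite ltr_wpDl.
  have eC : 0 < e / (`|C2| + 1) by rewrite divr_gt0.
  near=> h.
  rewrite /= !fctE /= /inner_with vL [h + x]addrC opprD addrA.
  apply: (le_trans (F_le h)); rewrite expr2 mulrA ler_wpM2r//.
  apply: (@le_trans _ _ ((`|C2| + 1) * `|h|)).
    by rewrite ler_wpM2r// (le_trans (ler_norm _))// lerDl.
  by rewrite mulrC -ler_pdivlMr//; near: h; exact: nbhs0_le.
have dF : 'd F x = inner_with v :> (H -> R).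
  exact: (diff_unique (df := inner_with v : {linear H -> R^o})
    (@inner_with_continuous v) Fo).
split.
  apply/diff_locallyP; rewrite dF; split=> //; exact: inner_with_continuous.
have grad_ex : exists w, forall h, 'd F x h = inner w h.
  by exists v => h; rewrite dF.
move=> h; rewrite -vL; have := getPex grad_ex h; rewrite -/(gradient F x).
by move=> <-; rewrite dF.
Unshelve. all: by end_near. Qed.

End gradient.

(** * The norm of a Bochner integral *)

Section bochner_bound.
Context {R : realType} {dT : measure_display} {T : measurableType dT}.
Context {H : hilbertType R} (mu : probability T R).
Implicit Types (s : {fimfun T >-> H}) (F : T -> H) (K : T -> R).

(** Monotonicity of the integral of nonnegative functions, without any
    measurability assumption. *)
Lemma ge0_le_integralT (f g : T -> \bar R) :
  (forall y, 0 <= f y)%E -> (forall y, f y <= g y)%E ->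
  (\int[mu]_y f y <= \int[mu]_y g y)%E.
Proof.
move=> f0 fg; have g0 y : (0 <= g y)%E := le_trans (f0 y) (fg y).
rewrite !ge0_integralTE//; apply: le_ereal_sup => _ [h hf <-].
by exists h => // y; exact: le_trans (hf y) (fg y).
Qed.

Lemma fimfun_normE s y : `|s y| =
  \sum_(h <- fset_set (range s)) `|h| * \1_(s @^-1` [set h]) y.
Proof.
rewrite (bigD1_seq (s y)) ?fset_uniq//=; last first.
  by rewrite in_fset_set//; apply: mem_set; exists y.
rewrite indicE mem_set// mulr1 big1 ?addr0// => h hy.
by rewrite indicE memNset ?mulr0// => /= yh; rewrite yh eqxx in hy.
Qed.

Lemma measurable_fimfun_norm s : (forall h, measurable (s @^-1` [set h])) ->
  measurable_fun setT (fun y => `|s y|).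
Proof.
move=> sm; under eq_fun do rewrite fimfun_normE.
by apply: measurable_sum => h; apply: measurable_funM.
Qed.

Lemma normr_simple_integral_le s : (forall h, measurable (s @^-1` [set h])) ->
  (`|simple_integral mu s|%:E <= \int[mu]_y `|s y|%:E)%E.
Proof.
move=> sm; have -> : (\int[mu]_y `|s y|%:E =
    \sum_(h <- fset_set (range s)) (`|h| * fine (mu (s @^-1` [set h])))%:E)%E.
  under eq_integral do rewrite fimfun_normE -sumEFin.
  rewrite ge0_integral_sum//; last first.
    by move=> h; apply/measurable_EFinP; exact: measurable_funM.
  apply: eq_bigr => h _; under eq_integral do rewrite EFinM.
  rewrite ge0_integralZl//; last exact/measurable_EFinP.
  by rewrite integral_indic// setIT EFinM fineK// fin_num_measure.
rewrite sumEFin lee_fin /simple_integral fsbig_finite//=.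
apply: (le_trans (ler_norm_sum _ _ _)); apply: ler_sum => h _.
by rewrite normrZ mulrC ler_wpM2l// ger0_norm// fine_ge0.
Qed.

(** The approximating simple functions need not be dominated by K; the excess
    of their norms over K is controlled by the distance to F. *)
Lemma has_bochner_integral_norm_le F K v :
  mu.-integrable setT (EFin \o K) -> (forall y, `|F y| <= K y) ->
  has_bochner_integral mu F v -> (`|v|%:E <= \int[mu]_y (K y)%:E)%E.
Proof.
move=> Ki FK [s [sm _ sF sv]].
have K0 y : 0 <= K y := le_trans (normr_ge0 _) (FK y).
have mK : measurable_fun setT K by apply/measurable_EFinP; case/integrableP : Ki.
pose e n : \bar R := (\int[mu]_y `|F y - s n y|%:E)%E.
have sK n : (`|simple_integral mu (s n)|%:E <= \int[mu]_y (K y)%:E + e n)%E.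
  apply: (le_trans (normr_simple_integral_le (sm n))).
  (* the positive part of |s_n| - K: it is measurable, whereas the measurability
     of |F - s_n| is not known *)
  pose D y := Num.max (`|s n y| - K y) 0.
  have D0 y : 0 <= D y by rewrite le_max lexx orbT.
  have mD : measurable_fun setT D.
    apply: measurable_maxr => //; apply: measurable_funB => //.
    exact: measurable_fimfun_norm.
  apply: (@le_trans _ _ (\int[mu]_y (K y + D y)%:E)%E).
    apply: ge0_le_integralT => y; rewrite lee_fin// -lerBlDl.
    by rewrite le_max lexx.
  under eq_integral do rewrite EFinD.
  rewrite ge0_integralD//; last 4 first.
  - by move=> y _; rewrite lee_fin.
  - exact/measurable_EFinP.
  - by move=> y _; rewrite lee_fin.
  - exact/measurable_EFinP.
  apply: leeD2l; apply: ge0_le_integralT => y; rewrite lee_fin//.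
  rewrite ge_max normr_ge0 andbT lerBlDl (le_trans _ (lerD (FK y) (lexx _)))//.
  by rewrite distrC -{1}(subrKC (F y) (s n y)) ler_normD.
have v_cvg : (`|simple_integral mu (s n)|%:E @[n --> \oo] --> `|v|%:E)%E.
  apply: cvg_EFin; first by near=> n.
  exact: cvg_norm.
have K_cvg : ((\int[mu]_y (K y)%:E + e n)%E @[n --> \oo] -->
    (\int[mu]_y (K y)%:E + 0)%E).
  apply: cvgeD => //; last exact: cvg_cst.
  by rewrite fin_num_adde_defl.
rewrite -(adde0 (integral _ _ _)); apply: (lee_cvg_to v_cvg K_cvg).
by near=> n; exact: sK.
Unshelve. all: by end_near. Qed.

Lemma bochner_integral_norm_le F K : bochner_integrable mu F ->
  mu.-integrable setT (EFin \o K) -> (forall y, `|F y| <= K y) ->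
  (`|bochner_integral mu F|%:E <= \int[mu]_y (K y)%:E)%E.
Proof.
by move=> Fi Ki FK; apply: has_bochner_integral_norm_le FK _ => //; exact: getPex.
Qed.

End bochner_bound.

(** * Operators on Euclidean space and coercivity of the Gram matrix *)

Lemma opnorm_bound (R : realType) (V W : normedModType R) (T : {linear V -> W})
  v : continuous T -> `|T v| <= opnorm T * `|v|.
Proof.
move=> /linear_lipschitz[k k0 Tk].
have [->|v0] := eqVneq v 0; first by rewrite linear0 !normr0 mulr0.
have vn : 0 < `|v| by rewrite normr_gt0.
rewrite -ler_pdivrMr//; apply: ub_le_sup.
  exists k => _ [u /= u1 <-]; apply: (le_trans (Tk u)).
  by rewrite ler_piMr// ltW.
exists (`|v|^-1 *: v).
  by rewrite /= normrZ gtr0_norm ?invr_gt0// mulVf ?gt_eqF.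
by rewrite linearZ normrZ gtr0_norm ?invr_gt0// mulrC.
Qed.

Section euclid.
Context {R : realType} {d : nat}.
Implicit Types u v : euclid R d.

(** The i-th vector of the canonical basis. *)
Definition unit_vector (i : 'I_d) : euclid R d := delta_mx 0 i.

Lemma euclid_innerE u v : inner u v = \sum_(i < d) u ord0 i * v ord0 i.
Proof. by []. Qed.

Lemma euclid_inner_mulmx u v : inner u v = ((u : 'rV_d) *m (v : 'rV_d)^T) ord0 ord0.
Proof. by rewrite euclid_innerE mxE; apply: eq_bigr => i _; rewrite mxE. Qed.

Lemma inner_unit_vector u i : inner u (unit_vector i) = u ord0 i.
Proof.
rewrite euclid_innerE (bigD1 i)//= big1 ?addr0 => [|j ji].
  by rewrite !mxE !eqxx mulr1.
by rewrite !mxE (negbTE ji) andbF mulr0.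
Qed.

Lemma normr_unit_vector i : `|unit_vector i| = 1.
Proof.
apply/eqP; rewrite -(@eqrXn2 _ 2)// expr1n inner_normE inner_unit_vector.
by rewrite !mxE !eqxx.
Qed.

Lemma normr_coord_le u i : `|u ord0 i| <= `|u|.
Proof.
rewrite -inner_unit_vector (le_trans (normr_inner_le _ _))//.
by rewrite normr_unit_vector mulr1.
Qed.

Lemma sum_mul_sqr_le (a b : 'I_d -> R) :
  (\sum_i a i * b i) ^+ 2 <= (\sum_i a i ^+ 2) * (\sum_i b i ^+ 2).
Proof.
have := normr_inner_le (\row_i a i : euclid R d) (\row_i b i).
rewrite -(ler_pXn2r (n := 2)) ?nnegrE ?mulr_ge0// exprMn !inner_normE.
rewrite real_normK ?num_real// !euclid_innerE.
have sE (x y : 'I_d -> R) :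
    \sum_i (\row_k x k : 'rV_d) ord0 i * (\row_k y k : 'rV_d) ord0 i =
    \sum_i x i * y i by apply: eq_bigr => i _; rewrite !mxE.
by rewrite !sE => h; exact: h.
Qed.

Section image.
Context {V : hilbertType R} (T : {linear euclid R d -> V}).

(** The squared Hilbert-Schmidt norm of T, i.e. the trace of T^* T. *)
Definition hs_sqr : R := \sum_(i < d) `|T (unit_vector i)| ^+ 2.

Lemma hs_sqr_ge0 : 0 <= hs_sqr.
Proof. by apply: sumr_ge0 => i _; exact: sqr_ge0. Qed.

Lemma linear_unit_vectorE u : T u = \sum_i u ord0 i *: T (unit_vector i).
Proof.
rewrite {1}(row_sum_delta u) linear_sum; apply: eq_bigr => i _.
by rewrite -linearZ.
Qed.

Lemma normr_sqr_hs_le u : `|T u| ^+ 2 <= hs_sqr * `|u| ^+ 2.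
Proof.
rewrite linear_unit_vectorE mulrC.
(* triangle inequality, then Cauchy-Schwarz in the coordinates *)
apply: (@le_trans _ _ ((\sum_i `|u ord0 i| * `|T (unit_vector i)|) ^+ 2)).
  rewrite ler_pXn2r ?nnegrE//; last by apply: sumr_ge0 => i _; rewrite mulr_ge0.
  by apply: (le_trans (ler_norm_sum _ _ _)); apply: ler_sum => i _; rewrite normrZ.
apply: (le_trans (sum_mul_sqr_le _ _)); rewrite inner_normE euclid_innerE.
rewrite (_ : \sum_i `|u ord0 i| ^+ 2 = \sum_i u ord0 i * u ord0 i)//.
by apply: eq_bigr => i _; rewrite real_normK ?num_real// expr2.
Qed.

Lemma adjointE u w : inner (T u) w = inner u (adjoint T w).
Proof.
suff /getPex : exists v, forall u, inner (T u) w = inner u v by [].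
have [||v vE] := @riesz _ _ (fun u => inner (T u) w) (Num.sqrt hs_sqr * `|w|).
- by move=> a x y; rewrite linearP innerDl innerZl.
- move=> v; apply: (le_trans (normr_inner_le _ _)).
  rewrite mulrAC ler_wpM2r//.
  rewrite -(ler_pXn2r (n := 2)) ?nnegrE ?mulr_ge0 ?sqrtr_ge0// exprMn.
  by rewrite sqr_sqrtr ?hs_sqr_ge0// normr_sqr_hs_le.
by exists v => x; rewrite -vE innerC.
Qed.

End image.

(** The spectral theorem is not needed: a positive semidefinite matrix with a
    positive smallest eigenvalue is invertible, and expanding its form b at
    v - t w with w = v M^-1 gives 0 <= b(v, v) - 2 t |v|^2 + t^2 <v, w>, from
    which t = 1/C, with <v, w> <= C |v|^2, gives b(v, v) >= |v|^2 / C. *)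
Lemma sigma_min_coercive (M : 'M[R]_d) : M^T = M ->
  (forall v : 'rV[R]_d, 0 <= (v *m M *m v^T) ord0 ord0) ->
  0 < sigma_min M ->
  exists2 c, 0 < c & forall v, c * `|v| ^+ 2 <=
    ((v : 'rV_d) *m M *m (v : 'rV_d)^T) ord0 ord0.
Proof.
move=> MT M_ge0 M_gt0.
have eig_ge0 a : eigenvalue M a -> 0 <= a.
  move=> /eigenvalueP[v va v0]; have := M_ge0 v.
  rewrite va -scalemxAl mxE -(@euclid_inner_mulmx v v) -inner_normE.
  by rewrite pmulr_lge0// exprn_gt0// normr_gt0.
have M_unit : M \in unitmx.
  rewrite unitmxE unitfE; apply/negP => /det0P[v v0 vM].
  have : sigma_min M <= 0; last by rewrite leNgt M_gt0.
  apply: ge_inf; first by exists 0 => a /= /eig_ge0.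
  by apply/eigenvalueP; exists v; rewrite ?scale0r.
pose N := invmx M.
(* C bounds the quadratic form of M^-1 *)
pose C : R := 1 + \sum_i \sum_j `|N i j|.
have C0 : 0 < C by rewrite ltr_pwDl// sumr_ge0// => i _; rewrite sumr_ge0.
exists C^-1; first by rewrite invr_gt0.
move=> v; pose w : euclid R d := (v : 'rV_d) *m N.
pose b (x y : 'rV[R]_d) := (x *m M *m y^T) ord0 ord0.
have bC x y : b x y = b y x.
  rewrite /b -[in RHS](trmxK (y *m M *m x^T)) [RHS]mxE.
  by rewrite !trmx_mul trmxK MT mulmxA.
have bP t : b (v - t *: w) (v - t *: w) = b v v - 2 * t * b w v + t ^+ 2 * b w w.
  have e x y z : b (x - t *: y) z = b x z - t * b y z.
    by rewrite /b mulmxBl -scalemxAl mulmxBl -scalemxAl !mxE.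
  by rewrite e !(bC _ (v - _)) !e (bC w v); ring.
have bw x : b w x = inner v x.
  by rewrite /b /w -(mulmxA v) mulVmx// mulmx1 euclid_inner_mulmx.
have bwC : b w w <= C * `|v| ^+ 2.
  rewrite bw euclid_innerE mulrDl mul1r ler_wpDl ?sqr_ge0//.
  rewrite exchange_big mulr_suml; apply: ler_sum => j _.
  rewrite mxE mulr_sumr mulr_suml; apply: ler_sum => i _.
  apply: (le_trans (ler_norm _)); rewrite !normrM mulrA mulrC ler_wpM2l// expr2.
  by rewrite ler_pM// normr_coord_le.
have := M_ge0 (v - C^-1 *: w); rewrite -/(b _ _) bP bw -inner_normE => h.
have : C^-1 ^+ 2 * b w w <= C^-1 * `|v| ^+ 2.
  by rewrite expr2 -mulrA ler_wpM2l ?invr_ge0 ?(ltW C0)// mulrC ler_pdivrMr// mulrC.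
rewrite -/(b _ _); lra.
Qed.

End euclid.

Lemma gramE (R : realType) (U : ptopologicalType) (V : hilbertType R) (d : nat)
    (B : U -> {linear euclid R d -> V}) y i j :
  gram B y i j = inner (B y (unit_vector i)) (B y (unit_vector j)).
Proof.
rewrite /gram mxE -inner_unit_vector innerC -adjointE innerC.
by [].
Qed.

(** * The objective at one sample *)

Lemma inner_diff_le (R : realType) (H : hilbertType R) (u v e : H) :
  `|e| = 1 -> inner u e - inner v e <= `|u| + `|v|.
Proof.
move=> e1; rewrite -innerBl (le_trans (inner_le_norm _ _))// e1 mulr1.
exact: ler_normB.
Qed.

Section hprod.
Context {R : realType} {V W : hilbertType R}.
Implicit Types x : hprod V W.

Lemma hprod_norm_sqr x : `|x| ^+ 2 = `|x.1| ^+ 2 + `|x.2| ^+ 2.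
Proof. by rewrite !inner_normE. Qed.

Lemma hprod_norm1_le x : `|x.1| <= `|x|.
Proof. by rewrite -(ler_pXn2r (n := 2)) ?nnegrE// hprod_norm_sqr lerDl sqr_ge0. Qed.

Lemma hprod_norm2_le x : `|x.2| <= `|x|.
Proof. by rewrite -(ler_pXn2r (n := 2)) ?nnegrE// hprod_norm_sqr lerDr sqr_ge0. Qed.

End hprod.

Section sample.
Context {R : realType} {V W Z J : hilbertType R} {d : nat}.
Context (T : {linear euclid R d -> V}) (A : {linear V -> W}).
Context (C : {linear Z -> W}) (Q : {linear V -> J}) (u0 : J) (alpha : R).
Local Notation X := (hprod Z (euclid R d)).
Implicit Types (x h : X) (s l : R).

(** The tracked quantity Q u, where u = T t is the surrogate. *)
Definition state x : J := Q (T x.2).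

(** The defect of the state equation; its squared norm is the residual g. *)
Definition defect x : W := A (T x.2) - C x.1.

Lemma stateP a x h : state (a *: x + h) = a *: state x + state h.
Proof. by rewrite /state /= !linearP. Qed.

Lemma defectP a x h : defect (a *: x + h) = a *: defect x + defect h.
Proof. by rewrite /defect /= !linearP/= scalerDr addrACA. Qed.

(** The weighted sum of the tracking cost and the squared residual at one
    sample; the weights (1, 0), (0, 1) and (1, lambda) give f, g and the
    penalized objective. *)
Definition objective s l x : R :=
  s * (2^-1 * `|state x - u0| ^+ 2 + alpha / 2 * `|x.1| ^+ 2) +
  l * `|defect x| ^+ 2.

(** The part of the increment of the objective from x to x + h that is linear
    in h. *)
Definition objective_lin s l x h : R :=
  s * (inner (state x - u0) (state h) + alpha * inner x.1 h.1) +
  l * (2 * inner (defect x) (defect h)).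

(** The part of the increment of the objective that is quadratic in h; it does
    not depend on x. *)
Definition objective_quad s l h : R :=
  s * (2^-1 * `|state h| ^+ 2 + alpha / 2 * `|h.1| ^+ 2) +
  l * `|defect h| ^+ 2.

Lemma objectiveD s l x h : objective s l (x + h) =
  objective s l x + objective_lin s l x h + objective_quad s l h.
Proof.
have sD : state (x + h) - u0 = state x - u0 + state h.
  by have := stateP 1 x h; rewrite !scale1r => ->; rewrite addrAC.
have dD : defect (x + h) = defect x + defect h.
  by have := defectP 1 x h; rewrite !scale1r.
rewrite /objective sD dD (_ : (x + h).1 = x.1 + h.1)//.
rewrite (normr_sqrD (state x - u0)) (normr_sqrD x.1) (normr_sqrD (defect x)).
by rewrite /objective_lin /objective_quad; field.
Qed.

Lemma objective_linP s l x a h k : objective_lin s l x (a *: h + k) =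
  a * objective_lin s l x h + objective_lin s l x k.
Proof.
rewrite /objective_lin stateP defectP (_ : (a *: h + k).1 = a *: h.1 + k.1)//.
move: (state x - u0) (state h) (state k) => v1 v2 v3.
move: (defect x) (defect h) (defect k) => w1 w2 w3.
by rewrite !innerDr !innerZr; ring.
Qed.

Lemma objective_lin_diag s l x h : objective_lin s l (x + h) h =
  objective_lin s l x h + 2 * objective_quad s l h.
Proof.
have sD : state (x + h) - u0 = state x - u0 + state h.
  by have := stateP 1 x h; rewrite !scale1r => ->; rewrite addrAC.
have dD : defect (x + h) = defect x + defect h.
  by have := defectP 1 x h; rewrite !scale1r.
rewrite /objective_lin sD dD (_ : (x + h).1 = x.1 + h.1)//.
rewrite /objective_quad !inner_normE.
move: (state x - u0) (state h) (defect x) (defect h) => v1 v2 w1 w2.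
by rewrite !innerDl; field.
Qed.

Lemma objective_quadZ s l a h :
  objective_quad s l (a *: h) = a ^+ 2 * objective_quad s l h.
Proof.
rewrite /objective_quad (_ : (a *: h).1 = a *: h.1)//.
have -> : state (a *: h) = a *: state h by rewrite /state /= !linearZ.
have -> : defect (a *: h) = a *: defect h.
  by rewrite /defect /= !linearZ/= scalerDr.
by rewrite !normrZ !exprMn !real_normK ?num_real//; ring.
Qed.

(** The quadratic part as a combination of values of the objective, from which
    it inherits integrability. *)
Lemma objective_quadE s l h : objective_quad s l h =
  2^-1 * (objective s l h + objective s l (- h)) - objective s l 0.
Proof.
have qN : objective_quad s l (- h) = objective_quad s l h.
  have sN : state (- h) = - state h by rewrite /state /= !linearN.
  have dN : defect (- h) = - defect h.
    by rewrite /defect /= !linearN/= opprD.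
  by rewrite /objective_quad sN dN (_ : (- h).1 = - h.1)// !normrN.
have lN : objective_lin s l 0 (- h) = - objective_lin s l 0 h.
  have := objective_linP s l 0 (-1) h 0; have := objective_linP s l 0 1 0 0.
  by rewrite scaleN1r scale1r !addr0; lra.
have := objectiveD s l 0 h; have := objectiveD s l 0 (- h).
by rewrite !add0r qN lN => -> ->; field.
Qed.

Section bounds.
Context (M : R) (M1 : 1 <= M) (A_le : forall v, `|A v| <= M * `|v|)
  (C_le : forall z, `|C z| <= M * `|z|) (Q_le : forall v, `|Q v| <= M * `|v|)
  (u0_le : `|u0| <= M) (alpha_ge0 : 0 <= alpha) (alpha_le : alpha <= M).

Let sig := Num.sqrt (hs_sqr T).
Let sig0 : 0 <= sig. Proof. exact: sqrtr_ge0. Qed.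
Let sigE : sig ^+ 2 = hs_sqr T. Proof. by rewrite sqr_sqrtr ?hs_sqr_ge0. Qed.
Let M0 : 0 <= M. Proof. exact: le_trans M1. Qed.

Let T_le x : `|T x.2| <= sig * `|x|.
Proof.
rewrite -(ler_pXn2r (n := 2)) ?nnegrE ?mulr_ge0// exprMn sigE.
apply: (le_trans (normr_sqr_hs_le _ _)); rewrite ler_wpM2l ?hs_sqr_ge0//.
by rewrite ler_pXn2r ?nnegrE// hprod_norm2_le.
Qed.

Let state_le x : `|state x| <= M * (1 + sig) * `|x|.
Proof.
apply: (le_trans (Q_le _)); rewrite -mulrA ler_wpM2l//.
by apply: (le_trans (T_le _)); rewrite ler_wpM2r// lerDr.
Qed.

Let defect_le x : `|defect x| <= M * (1 + sig) * `|x|.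
Proof.
apply: (le_trans (ler_normB _ _)).
rewrite addrC -mulrA mulrDl mul1r mulrDr lerD//.
  by apply: (le_trans (C_le _)); rewrite ler_wpM2l// hprod_norm1_le.
by apply: (le_trans (A_le _)); rewrite ler_wpM2l.
Qed.

Let sig1_sqr : (1 + sig) ^+ 2 <= 2 * (1 + hs_sqr T).
Proof. rewrite -sigE; have := sqr_ge0 (1 - sig); nra. Qed.

(* alpha <= M <= (M (1 + sig))^2 *)
Let alpha_le_sqr : alpha <= (M * (1 + sig)) ^+ 2.
Proof.
have Ms : M <= M * (1 + sig) by rewrite ler_peMr// lerDl.
have P1 : 1 <= M * (1 + sig) := le_trans M1 Ms.
by rewrite (le_trans alpha_le)// (le_trans Ms)// expr2 ler_peMr// (le_trans _ P1).
Qed.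

Let mul_norm_le (K a b : R) (m n : R) : 0 <= a -> 0 <= b -> 0 <= m -> 0 <= n ->
  a <= K * m -> b <= K * n -> a * b <= K ^+ 2 * (m * n).
Proof.
move=> a0 b0 m0 n0 am bn; rewrite expr2 mulrACA; exact: ler_pM.
Qed.

Lemma objective_lin_le s l x h : 0 <= s -> 0 <= l ->
  `|objective_lin s l x h| <=
  4 * M ^+ 2 * (s + l) * (1 + hs_sqr T) * (1 + `|x|) * `|h|.
Proof.
move=> s0 l0; set K := M * (1 + sig).
have K1 : M <= K by rewrite ler_peMr// lerDl.
have P : K ^+ 2 <= 2 * M ^+ 2 * (1 + hs_sqr T).
  by rewrite /K exprMn [2 * _]mulrC -(mulrA (M ^+ 2)) ler_wpM2l ?sqr_ge0.
have e1 : `|inner (state x - u0) (state h)| <= K ^+ 2 * ((1 + `|x|) * `|h|).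
  apply: (le_trans (normr_inner_le _ _)); apply: mul_norm_le => //.
  apply: (le_trans (ler_normB _ _)); rewrite mulrDr mulr1 addrC lerD//.
  exact: le_trans u0_le K1.
have e2 : `|alpha * inner x.1 h.1| <= K ^+ 2 * (`|x| * `|h|).
  rewrite normrM ger0_norm// ler_pM// (le_trans (normr_inner_le _ _))//.
  by rewrite ler_pM// hprod_norm1_le.
have e3 : `|inner (defect x) (defect h)| <= K ^+ 2 * (`|x| * `|h|).
  by apply: (le_trans (normr_inner_le _ _)); exact: mul_norm_le.
have xh : `|x| * `|h| <= (1 + `|x|) * `|h| by rewrite ler_wpM2r// lerDr.
have {}e2 := le_trans e2 (ler_wpM2l (sqr_ge0 K) xh).
have {}e3 := le_trans e3 (ler_wpM2l (sqr_ge0 K) xh).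
set m := (1 + `|x|) * `|h| in e1 e2 e3 xh.
have m0 : 0 <= m by rewrite mulr_ge0// addr_ge0.
have -> : 4 * M ^+ 2 * (s + l) * (1 + hs_sqr T) * (1 + `|x|) * `|h| =
    (2 * (s + l)) * (2 * M ^+ 2 * (1 + hs_sqr T) * m) by rewrite /m; ring.
apply: (@le_trans _ _ ((2 * (s + l)) * (K ^+ 2 * m))); last first.
  by rewrite ler_wpM2l ?mulr_ge0 ?addr_ge0// ler_wpM2r.
apply: (le_trans (ler_normD _ _)); rewrite (mulrDr 2) (mulrDl (2 * s)) lerD//.
  rewrite normrM ger0_norm// [2 * s]mulrC -(mulrA s) ler_wpM2l//.
  by apply: (le_trans (ler_normD _ _)); rewrite mulrDl mul1r lerD.
rewrite normrM ger0_norm// normrM ger0_norm// mulrA [l * 2]mulrC.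
by rewrite ler_wpM2l// mulr_ge0.
Qed.

Lemma objective_quad_ge0 s l h : 0 <= s -> 0 <= l -> 0 <= objective_quad s l h.
Proof.
by move=> s0 l0; rewrite !(addr_ge0, mulr_ge0)// invr_ge0.
Qed.

Lemma objective_quad_le s l h : 0 <= s -> 0 <= l ->
  objective_quad s l h <= 4 * M ^+ 2 * (s + l) * (1 + hs_sqr T) * `|h| ^+ 2.
Proof.
move=> s0 l0; set K := M * (1 + sig).
have P : K ^+ 2 <= 2 * M ^+ 2 * (1 + hs_sqr T).
  by rewrite /K exprMn [2 * _]mulrC -(mulrA (M ^+ 2)) ler_wpM2l ?sqr_ge0.
have K0 : 0 <= K by rewrite mulr_ge0// addr_ge0.
have e1 : `|state h| ^+ 2 <= K ^+ 2 * `|h| ^+ 2.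
  by rewrite -exprMn ler_pXn2r ?nnegrE// mulr_ge0.
have e2 : alpha * `|h.1| ^+ 2 <= K ^+ 2 * `|h| ^+ 2.
  by rewrite ler_pM ?sqr_ge0// ler_pXn2r ?nnegrE// hprod_norm1_le.
have e3 : `|defect h| ^+ 2 <= K ^+ 2 * `|h| ^+ 2.
  by rewrite -exprMn ler_pXn2r ?nnegrE// mulr_ge0.
apply: (@le_trans _ _ ((s + l) * (K ^+ 2 * `|h| ^+ 2))).
  rewrite mulrDl lerD// ler_wpM2l//; lra.
have -> : 4 * M ^+ 2 * (s + l) * (1 + hs_sqr T) * `|h| ^+ 2 =
   (s + l) * (2 * (2 * M ^+ 2 * (1 + hs_sqr T)) * `|h| ^+ 2) by ring.
rewrite ler_wpM2l ?addr_ge0// ler_wpM2r ?sqr_ge0//.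
by rewrite (le_trans P)// ler_peMl// ?ler1n// (le_trans _ P)// sqr_ge0.
Qed.

Lemma objective_gradient s l x : 0 <= s -> 0 <= l ->
  differentiable (objective s l) x /\
  forall h, inner (gradient (objective s l) x) h = objective_lin s l x h.
Proof.
move=> s0 l0; apply: gradient_expansion.
- exact: objective_linP.
- by move=> v; exact: objective_lin_le.
- move=> h; rewrite objectiveD.
  rewrite (_ : _ - _ - _ = objective_quad s l h); last by ring.
  by rewrite ger0_norm ?objective_quad_ge0//; exact: objective_quad_le.
Qed.

Lemma objective_gradient_le s l x : 0 <= s -> 0 <= l ->
  `|gradient (objective s l) x| <=
  4 * M ^+ 2 * (s + l) * (1 + hs_sqr T) * (1 + `|x|).
Proof.
move=> s0 l0; apply: normr_le_dual.
  by rewrite !mulr_ge0 ?addr_ge0 ?sqr_ge0 ?hs_sqr_ge0.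
move=> h; rewrite (objective_gradient x s0 l0).2.
exact: le_trans (ler_norm _) (objective_lin_le _ _ s0 l0).
Qed.

(** The Hilbert-Schmidt norm is controlled by the gradient: testing the increment
    of the gradient from 0 to a coordinate vector e_i against e_i gives twice the
    quadratic part at e_i, which is at least |Q (T e_i)|^2. *)
Lemma hs_sqr_le_gradient l (kS : R) : 0 <= l -> 0 <= kS ->
  (forall v, `|v| <= kS * `|Q v|) ->
  hs_sqr T <= kS ^+ 2 * \sum_(i < d)
    (`|gradient (objective 1 l) (0, unit_vector i)| +
     `|gradient (objective 1 l) 0|).
Proof.
move=> l0 kS0 QS; rewrite /hs_sqr mulr_sumr; apply: ler_sum => i _.
have [e [eE e_norm]] : exists e : X, (0, unit_vector i) = e /\ `|e| = 1.
  exists (0, unit_vector i); split=> //; apply/eqP.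
  rewrite -(@eqrXn2 _ 2)// expr1n hprod_norm_sqr /= normr0.
  by rewrite normr_unit_vector expr0n expr1n add0r.
have e2 : e.2 = unit_vector i by rewrite -eE.
rewrite eE; have grad x := (objective_gradient x ler01 l0).2.
have : 2 * objective_quad 1 l e <=
    `|gradient (objective 1 l) e| + `|gradient (objective 1 l) 0|.
  have diag := objective_lin_diag 1 l 0 e; rewrite add0r -!grad in diag.
  have subr_le (a b c r : R) : a = b + c -> a - b <= r -> c <= r.
    by move=> ->; rewrite addrC addKr.
  exact: subr_le diag (inner_diff_le _ _ e_norm).
move=> /(ler_wpM2l (sqr_ge0 kS)); apply: le_trans.
apply: (@le_trans _ _ ((kS * `|Q (T (unit_vector i))|) ^+ 2)).
  by rewrite ler_pXn2r ?nnegrE// mulr_ge0.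
rewrite exprMn ler_wpM2l ?sqr_ge0//.
rewrite /objective_quad /state e2 mul1r -addrA mulrDr mulrA divff// mul1r lerDl.
by rewrite mulr_ge0// addr_ge0// mulr_ge0// ?sqr_ge0// mulr_ge0// invr_ge0.
Qed.

End bounds.

Lemma objective_quad_ge l (kS : R) h : 0 <= l -> 0 < kS ->
  (forall v, `|v| <= kS * `|Q v|) ->
  2^-1 / kS ^+ 2 * `|T h.2| ^+ 2 + alpha / 2 * `|h.1| ^+ 2 <=
  objective_quad 1 l h.
Proof.
move=> l0 kS0 QS; rewrite /objective_quad mul1r -addrA lerD//.
  rewrite -mulrA ler_wpM2l// mulrC ler_pdivrMr ?exprn_gt0// -exprMn mulrC.
  by rewrite ler_pXn2r ?nnegrE// ?mulr_ge0// ?(ltW kS0)//; exact: QS.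
by rewrite lerDl mulr_ge0// sqr_ge0.
Qed.

End sample.

(** * Expectations *)

Section inequalities.
Context {R : realFieldType}.

Lemma sqrrD_le2 (a b : R) : (a + b) ^+ 2 <= 2 * (a ^+ 2 + b ^+ 2).
Proof. by have := sqr_ge0 (a - b); lra. Qed.

Lemma ler_mul_chain (h k p q n : R) : 0 <= k -> 0 <= n ->
  h <= k * (q * n) -> q <= 2 * p -> 2 * h <= 4 * k * n * p.
Proof. by move=> k0 n0 hk /(ler_wpM2l (mulr_ge0 k0 n0)); lra. Qed.

End inequalities.

(** The linearity lemmas on integrability, for real-valued integrands. *)
Section real_integrable.
Context {R : realType} {dT : measure_display} {T : measurableType dT}.
Context (mu : probability T R).
Implicit Types f g : T -> R.
Local Notation integ f := (mu.-integrable setT (EFin \o f)).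

Lemma integrable_realD f g : integ f -> integ g -> integ (fun y => f y + g y).
Proof. by move=> fi gi; exact: (integrableD measurableT fi gi). Qed.

Lemma eq_integrable_real f g : f =1 g -> integ f -> integ g.
Proof. by move=> /funext ->. Qed.

Lemma integrable_realZ k f : integ f -> integ (fun y => k * f y).
Proof. by move=> fi; exact: (integrableZl measurableT k fi). Qed.

Lemma integrable_realB f g : integ f -> integ g -> integ (fun y => f y - g y).
Proof. by move=> fi gi; exact: (integrableB measurableT fi gi). Qed.

Lemma integrable_real_cst k : integ (fun=> k).
Proof. exact: finite_measure_integrable_cst. Qed.

Lemma integrable_real_sum (I : Type) (s : seq I) (F : I -> T -> R) :
  (forall i, integ (F i)) -> integ (fun y => \sum_(i <- s) F i y).
Proof.
move=> Fi; have : mu.-integrable setT (fun y => \sum_(i <- s) (F i y)%:E)%E.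
  by apply: integrable_sum => // i _; exact: Fi.
by apply: eq_integrable => // y _; rewrite /= sumEFin.
Qed.

Lemma integrable_real_le f g : measurable_fun setT f -> integ g ->
  (forall y, `|f y| <= g y) -> integ f.
Proof.
move=> mf gi fg; apply: (le_integrable _ _ _ gi) => //.
  exact/measurable_EFinP.
by move=> y _ /=; rewrite lee_fin (le_trans (fg y))// ler_norm.
Qed.

Lemma integrable_real_measurable f : integ f -> measurable_fun setT f.
Proof. by move=> /integrableP[/measurable_EFinP]. Qed.

Lemma integral_realE f : integ f ->
  (\int[mu]_y (f y)%:E = (\int[mu]_y f y)%R%:E)%E.
Proof. by move=> fi; rewrite /Rintegral fineK//; exact: integrable_fin_num. Qed.

End real_integrable.
Arguments integrable_real_cst {R dT T} mu k.

Section expected.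
Context {R : realType} {U : ptopologicalType} {V W Z J : hilbertType R}.
Context {d : nat} (mu : probability (borel_space U) R).
Context (A : U -> {linear V -> W}) (B : U -> {linear euclid R d -> V}).
Context (C : {linear Z -> W}) (Q : {linear V -> J}) (u0 : J) (alpha : R).
Local Notation X := (hprod Z (euclid R d)).
Local Notation obj s l x y := (objective (B y) (A y) C Q u0 alpha s l x).
Local Notation lin s l x h y := (objective_lin (B y) (A y) C Q u0 alpha s l x h).
Local Notation quad s l h y := (objective_quad (B y) (A y) C Q alpha s l h).
Local Notation hs y := (hs_sqr (B y)).
Local Notation integ f := (mu.-integrable setT (EFin \o f)).

Context (gram_int : forall i j, mu.-integrable setT (fun y => (gram B y i j)%:E)).

Lemma hs_sqr_gramE y : hs y = \sum_i gram B y i i.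
Proof. by apply: eq_bigr => i _; rewrite gramE inner_normE. Qed.

Lemma integrable_hs_sqr : integ (fun y => hs y).
Proof.
apply: (@eq_integrable_real _ _ _ _ (fun y : borel_space U =>
  \sum_i gram B y i i)).
  by move=> y; rewrite hs_sqr_gramE.
by apply: integrable_real_sum => i; exact: gram_int.
Qed.

Lemma integrable_hs1 : integ (fun y => 1 + hs y).
Proof. exact: integrable_realD (integrable_real_cst mu 1) integrable_hs_sqr. Qed.

Lemma normr_sqr_gramE y (t : euclid R d) : `|B y t| ^+ 2 =
  \sum_i \sum_j t ord0 i * t ord0 j * gram B y i j.
Proof.
rewrite inner_normE {1}linear_unit_vectorE inner_suml; apply: eq_bigr => i _.
rewrite innerZl innerC linear_unit_vectorE inner_suml mulr_sumr.
by apply: eq_bigr => j _; rewrite innerZl mulrA gramE innerC.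
Qed.

Lemma integrable_normr_sqr t : integ (fun y => `|B y t| ^+ 2).
Proof.
apply: (@eq_integrable_real _ _ _ _ (fun y : borel_space U =>
  \sum_i \sum_j t ord0 i * t ord0 j * gram B y i j)).
  by move=> y; rewrite normr_sqr_gramE.
by do 2!apply: integrable_real_sum => ?; exact: integrable_realZ (gram_int _ _).
Qed.

Lemma expected_gramE i j : expected_gram mu B i j = \int[mu]_y gram B y i j.
Proof. by rewrite mxE expectation.unlock. Qed.

(** The quadratic form of the expected Gram matrix is E |B t|^2. *)
Lemma expected_gram_form (t : euclid R d) :
  ((t : 'rV_d) *m expected_gram mu B *m (t : 'rV_d)^T) ord0 ord0 =
  \int[mu]_y `|B y t| ^+ 2.
Proof.
under eq_Rintegral do rewrite normr_sqr_gramE.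
rewrite mxE.
have sE (n : nat) (F : 'I_n -> borel_space U -> R) : (forall i, integ (F i)) ->
    \int[mu]_y (\sum_i F i y) = \sum_i \int[mu]_y F i y.
  move=> Fi; apply: EFin_inj.
  rewrite -integral_realE; last exact: integrable_real_sum.
  under eq_integral do rewrite -sumEFin.
  rewrite integral_sum//.
  rewrite -sumEFin; apply: eq_bigr => i _; exact: integral_realE.
rewrite sE => [|i]; last first.
  by apply: integrable_real_sum => j; exact: integrable_realZ (gram_int _ _).
rewrite [RHS](eq_bigr (fun i =>
    \sum_j t ord0 i * t ord0 j * expected_gram mu B i j)).
  rewrite exchange_big/=; apply: eq_bigr => j _; rewrite !mxE mulr_suml.
  by apply: eq_bigr => i _; ring.
move=> i _; rewrite sE => [|j]; last exact: integrable_realZ (gram_int _ _).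
apply: eq_bigr => j _; rewrite RintegralZl ?expected_gramE//.
exact: gram_int.
Qed.

Lemma expected_gram_coercive : 0 < sigma_min (expected_gram mu B) ->
  exists2 c, 0 < c & forall t, c * `|t| ^+ 2 <= \int[mu]_y `|B y t| ^+ 2.
Proof.
move=> /sigma_min_coercive[||c c0 cP].
- apply/matrixP => i j; rewrite mxE !expected_gramE.
  by apply: eq_Rintegral => y _; rewrite !gramE innerC.
- move=> t; rewrite (expected_gram_form t).
  by apply: Rintegral_ge0 => y _; exact: sqr_ge0.
by exists c => // t; rewrite -expected_gram_form.
Qed.

Context (M : R) (M1 : 1 <= M) (A_le : forall y v, `|A y v| <= M * `|v|)
  (C_le : forall z, `|C z| <= M * `|z|) (Q_le : forall v, `|Q v| <= M * `|v|)
  (u0_le : `|u0| <= M) (alpha_gt0 : 0 < alpha) (alpha_le : alpha <= M)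
  (kS : R) (kS0 : 0 < kS) (QS : forall v, `|v| <= kS * `|Q v|).

Let alpha0 : 0 <= alpha. Proof. exact: ltW. Qed.

(** Square integrability of the gradient at one nonnegative weight gives the fourth
    moment of the Hilbert-Schmidt norm, hence a bound uniform in the weight. *)
Lemma integrable_hs1_sqr l : 0 <= l ->
  (forall x, mu.-integrable setT
    (fun y => (`|gradient (objective (B y) (A y) C Q u0 alpha 1 l) x| ^+ 2)%:E)) ->
  integ (fun y => (1 + hs y) ^+ 2).
Proof.
move=> l0 grad_int.
pose G (x : X) (y : borel_space U) :=
  `|gradient (objective (B y) (A y) C Q u0 alpha 1 l) x|.
pose e i : X := (0, unit_vector i).
pose D (y : borel_space U) :=
  2 + 4 * kS ^+ 4 * d%:R * \sum_i (G (e i) y ^+ 2 + G 0 y ^+ 2).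
apply: (@integrable_real_le _ _ _ _ _ D).
- apply: measurable_funX; apply: integrable_real_measurable.
  exact: integrable_hs1.
- apply: integrable_realD; first exact: integrable_real_cst.
  apply: integrable_realZ; apply: integrable_real_sum => i.
  by apply: integrable_realD; exact: grad_int.
move=> y; rewrite ger0_norm ?sqr_ge0//.
have := hs_sqr_le_gradient (B y) M1 (A_le y) C_le Q_le u0_le alpha0 alpha_le
  l0 (ltW kS0) QS.
move=> hsG; have hs0 := hs_sqr_ge0 (B y).
have s1 : (1 + hs y) ^+ 2 <= 2 + 2 * hs y ^+ 2.
  by apply: (le_trans (sqrrD_le2 _ _)); rewrite expr1n mulrDr mulr1.
apply: (le_trans s1); rewrite /D lerD2l.
have s2 : hs y ^+ 2 <= (kS ^+ 2 * \sum_i (G (e i) y + G 0 y)) ^+ 2.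
  by rewrite ler_pXn2r ?nnegrE// (le_trans hs0 hsG).
have := @sum_mul_sqr_le _ _ (fun i => G (e i) y + G 0 y) (fun=> 1).
under eq_bigr do rewrite mulr1.
rewrite expr1n [X in _ * X]sumr_const card_ord => s3.
have s4 : \sum_i (G (e i) y + G 0 y) ^+ 2 <=
    2 * \sum_i (G (e i) y ^+ 2 + G 0 y ^+ 2).
  rewrite mulr_sumr; apply: ler_sum => i _.
  exact: sqrrD_le2.
have k4 : 0 <= kS ^+ 4 by rewrite exprn_ge0// ltW.
rewrite exprMn -exprM in s2.
have s5 := le_trans s2 (ler_wpM2l k4 s3).
have d0 : 0 <= d%:R :> R by [].
exact: ler_mul_chain k4 d0 s5 s4.
Qed.

Section Psi.
Context (l : R) (l_gt0 : 0 < l).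
Context (obj_int : forall x, integ (fun y => obj 1 l x y)).
Let l0 : 0 <= l. Proof. exact: ltW. Qed.
Let Psi x := \int[mu]_y obj 1 l x y.
Let Psi_lin x h := \int[mu]_y lin 1 l x h y.
Let Psi_quad h := \int[mu]_y quad 1 l h y.
Let N := 4 * M ^+ 2 * (1 + l) * \int[mu]_y (1 + hs y).

Let quad_int h : integ (fun y => quad 1 l h y).
Proof.
apply: (@eq_integrable_real _ _ _ _ (fun y : borel_space U =>
  2^-1 * (obj 1 l h y + obj 1 l (- h) y) - obj 1 l 0 y)).
  by move=> y; rewrite (objective_quadE _ _ _ _ u0).
apply: integrable_realB => //; apply: integrable_realZ.
exact: integrable_realD.
Qed.

Let lin_int x h : integ (fun y => lin 1 l x h y).
Proof.
apply: (@eq_integrable_real _ _ _ _ (fun y : borel_space U =>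
  (obj 1 l (x + h) y - obj 1 l x y) - quad 1 l h y)).
  by move=> y; rewrite objectiveD; ring.
by apply: integrable_realB => //; exact: integrable_realB.
Qed.

Let PsiD x h : Psi (x + h) = Psi x + Psi_lin x h + Psi_quad h.
Proof.
rewrite /Psi; under eq_Rintegral do rewrite objectiveD.
rewrite (RintegralD measurableT (integrable_realD (obj_int x) (lin_int x h)))//.
by rewrite (RintegralD measurableT (obj_int x)).
Qed.

Let Psi_lin_diag x h : Psi_lin (x + h) h = Psi_lin x h + 2 * Psi_quad h.
Proof.
rewrite /Psi_lin; under eq_Rintegral do rewrite objective_lin_diag.
rewrite (RintegralD measurableT (lin_int x h) (integrable_realZ 2 (quad_int h))).
by rewrite (RintegralZl _ measurableT (quad_int h)).
Qed.

Let Psi_linP x a h k : Psi_lin x (a *: h + k) = a * Psi_lin x h + Psi_lin x k.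
Proof.
rewrite /Psi_lin; under eq_Rintegral do rewrite objective_linP.
rewrite (RintegralD measurableT (integrable_realZ a (lin_int x h)) (lin_int x k)).
by rewrite (RintegralZl _ measurableT (lin_int x h)).
Qed.

Let int_hs1 k : \int[mu]_y (k * (1 + hs y)) = k * \int[mu]_y (1 + hs y).
Proof. by rewrite RintegralZl//; exact: integrable_hs1. Qed.

Let Psi_lin_le x h : `|Psi_lin x h| <= N * (1 + `|x|) * `|h|.
Proof.
apply: (le_trans (le_normr_Rintegral _ _)) => //.
rewrite (_ : N * _ * _ =
  \int[mu]_y (4 * M ^+ 2 * (1 + l) * (1 + `|x|) * `|h| * (1 + hs y))).
  apply: le_Rintegral => //; first exact: integrable_abse (lin_int x h).
    exact: integrable_realZ integrable_hs1.
  move=> y _.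
  apply: (le_trans (objective_lin_le (B y) M1 (A_le y) C_le Q_le u0_le alpha0
    alpha_le _ _ ler01 l0)).
  rewrite le_eqVlt; apply/orP; left; apply/eqP; ring.
rewrite int_hs1 /N; ring.
Qed.

Let Psi_quad_le h : Psi_quad h <= N * `|h| ^+ 2.
Proof.
rewrite (_ : N * _ = \int[mu]_y (4 * M ^+ 2 * (1 + l) * `|h| ^+ 2 * (1 + hs y))).
  apply: le_Rintegral => //; first exact: integrable_realZ integrable_hs1.
  move=> y _.
  apply: (le_trans (objective_quad_le (B y) M1 (A_le y) C_le Q_le alpha0
    alpha_le _ ler01 l0)).
  rewrite le_eqVlt; apply/orP; left; apply/eqP; ring.
rewrite int_hs1 /N; ring.
Qed.

Let Psi_quad_ge0 h : 0 <= Psi_quad h.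
Proof. by apply: Rintegral_ge0 => y _; exact: objective_quad_ge0. Qed.

Lemma Psi_gradient x : differentiable Psi x /\
  forall h, inner (gradient Psi x) h = Psi_lin x h.
Proof.
apply: gradient_expansion.
- exact: Psi_linP.
- exact: Psi_lin_le.
- move=> h; rewrite PsiD (_ : _ - _ - _ = Psi_quad h); last by ring.
  by rewrite ger0_norm.
Qed.

(** Property (i): the quadratic part is bounded below by a multiple of the
    squared norm, and the linear part at the minimiser xs is nonnegative. *)
Lemma Psi_strongly_monotone : 0 < sigma_min (expected_gram mu B) ->
  forall xs, (forall x, Psi xs <= Psi x) ->
  exists2 c, 0 < c &
    forall x, c * `|x - xs| ^+ 2 <= inner (x - xs) (gradient Psi x).
Proof.
move=> /expected_gram_coercive[c c0 cP] xs xs_min.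
pose k := 2^-1 / kS ^+ 2 * c.
have k0 : 0 < k by rewrite !mulr_gt0// invr_gt0// exprn_gt0.
have quad_ge h : Num.min k (alpha / 2) * `|h| ^+ 2 <= Psi_quad h.
  apply: (@le_trans _ _ (\int[mu]_y
      (2^-1 / kS ^+ 2 * `|B y h.2| ^+ 2 + alpha / 2 * `|h.1| ^+ 2))).
    have i1 : integ (fun y => 2^-1 / kS ^+ 2 * `|B y h.2| ^+ 2).
      exact: integrable_realZ (integrable_normr_sqr _).
    rewrite (RintegralD measurableT i1 (integrable_real_cst mu _)).
    rewrite (RintegralZl _ measurableT (integrable_normr_sqr _)).
    rewrite (Rintegral_cst mu measurableT) [X in fine X]probability_setT.
    rewrite mulr1 hprod_norm_sqr mulrDr addrC.
    rewrite lerD ?ler_wpM2r ?sqr_ge0 ?ge_min ?lexx ?orbT//.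
    apply: (@le_trans _ _ (k * `|h.2| ^+ 2)).
      by rewrite ler_wpM2r ?sqr_ge0// ge_min lexx.
    by rewrite /k -mulrA ler_wpM2l// divr_ge0// exprn_ge0// ltW.
  apply: le_Rintegral => //.
    apply: integrable_realD; last exact: integrable_real_cst.
    exact: integrable_realZ (integrable_normr_sqr _).
  by move=> y _; exact: objective_quad_ge.
exists (Num.min k (alpha / 2)); first by rewrite lt_min k0 divr_gt0.
move=> x; rewrite innerC (Psi_gradient x).2; set h := x - xs.
have lin_ge0 : 0 <= Psi_lin xs h.
  (* minimality along the segment from xs in the direction h *)
  have seg t : 0 <= t * Psi_lin xs h + t ^+ 2 * Psi_quad h.
    have := xs_min (xs + t *: h); rewrite PsiD.
    have -> : Psi_lin xs (t *: h) = t * Psi_lin xs h.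
      have := Psi_linP xs t h 0; have := Psi_linP xs 1 0 0.
      by rewrite !addr0 scaler0; lra.
    have -> : Psi_quad (t *: h) = t ^+ 2 * Psi_quad h.
      rewrite /Psi_quad -(RintegralZl _ measurableT (quad_int h)).
      by apply: eq_Rintegral => y _; exact: objective_quadZ.
    by lra.
  rewrite leNgt; apply/negP => neg.
  set p := Psi_lin xs h in seg neg; have q0 := Psi_quad_ge0 h.
  set q := Psi_quad h in seg q0.
  (* a negative slope p makes the increment negative at a small step *)
  have := seg (- p / (q + 1)); have q1 : 0 < q + 1 by lra.
  have -> : - p / (q + 1) * p + (- p / (q + 1)) ^+ 2 * q = - (p / (q + 1)) ^+ 2.
    by field; rewrite gt_eqF.
  rewrite oppr_ge0 leNgt exprn_even_gt0//=.
  by rewrite mulf_neq0 ?invr_eq0 ?(lt_eqF neg) ?(gt_eqF q1).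
have -> : Psi_lin x h = Psi_lin xs h + 2 * Psi_quad h.
  by rewrite -Psi_lin_diag /h subrKC.
by have := quad_ge h; have := Psi_quad_ge0 h; lra.
Qed.

End Psi.

End expected.

(** * Structural assumptions for the penalized method *)

Section identification.
Context {R : realType} {U : ptopologicalType} {V W Z J : hilbertType R}.
Context {d : nat} (mu : probability (borel_space U) R).
Context (A : U -> {linear V -> W}) (B : U -> {linear euclid R d -> V}).
Context (C : {linear Z -> W}) (Q : {linear V -> J}) (u0 : J) (alpha : R).
Local Notation f := (cost B Q u0 alpha).
Local Notation g := (residual B A C).
Local Notation obj s l y := (objective (B y) (A y) C Q u0 alpha s l).

Lemma cost_objective y : f ^~ y = obj 1 0 y.
Proof. by apply/funext => x; rewrite /objective mul1r mul0r addr0. Qed.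

Lemma residual_objective y : g ^~ y = obj 0 1 y.
Proof. by apply/funext => x; rewrite /objective mul0r mul1r add0r. Qed.

Lemma penalized_objective l y : penalized f g l ^~ y = obj 1 l y.
Proof. by apply/funext => x; rewrite /objective mul1r. Qed.

Lemma expected_penalizedE l :
  expected_penalized mu f g l = fun x => \int[mu]_y obj 1 l y x.
Proof.
apply/funext => x; rewrite /expected_penalized expectation.unlock.
by apply: eq_Rintegral => y _; rewrite -penalized_objective.
Qed.

End identification.

Theorem theorem6p4 (R : realType)
  (U : ptopologicalType) (U_compact : compact [set: U])
  (U_hausdorff : hausdorff_space U)
  (mu : probability (borel_space U) R)
  (V W Z J : hilbertType R)
  (A : U -> {linear V -> W}) (Ainv : U -> {linear W -> V})
  (a_min a_max : R)
  (A_bounded : forall y, continuous (A y))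
  (A_continuous : forall y0,
     opnorm (fun v => A y v - A y0 v) @[y --> y0] --> (0 : R))
  (A_inverse : forall y, bounded_inverse (A y) (Ainv y))
  (a_min_gt0 : 0 < a_min)
  (A_le : forall y, opnorm (A y) <= a_max)
  (Ainv_le : forall y, opnorm (Ainv y) <= 1 / a_min)
  (calB : {linear Z -> W}) (calBinv : {linear W -> Z})
  (calB_bounded : continuous calB)
  (calB_inverse : bounded_inverse calB calBinv)
  (Q : {linear V -> J}) (Qinv : {linear J -> V})
  (Q_bounded : continuous Q)
  (Q_inverse : bounded_inverse Q Qinv)
  (u0 : J) (alpha : R) (alpha_gt0 : 0 < alpha)
  (d : nat) (B : U -> {linear euclid R d -> V})
  (gram_integrable : forall i j,
     mu.-integrable setT (fun y => (gram B y i j)%:E))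
  (sigma_min_gt0 : 0 < sigma_min (expected_gram mu B))
  (X := hprod Z (euclid R d))
  (f : X -> U -> R := cost B Q u0 alpha)
  (g : X -> U -> R := residual B A calB)
  (lambda_bar : R) (lambda_bar_gt0 : 0 < lambda_bar)
  (lambda : nat -> R) (lambda_gt0 : forall k, 0 < lambda k)
  (lambda_mono : nonincreasing_seq (fun k => `|lambda k - lambda_bar| ^+ 2))
  (Psi : X -> R := expected_penalized mu f g lambda_bar)
  (Psi_integrable : forall x,
     mu.-integrable setT (fun y => (penalized f g lambda_bar x y)%:E))
  (grad_sqr_integrable : forall k x,
     mu.-integrable setT
       (fun y => (`|gradient (penalized f g (lambda k) ^~ y) x| ^+ 2)%:E))
  (grad_g_integrable : forall k x,
     bochner_integrable mu
       (fun y => (lambda k - lambda_bar) *: gradient (g ^~ y) x))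
  (xstar : X) (xstar_argmin : forall x, Psi xstar <= Psi x) :
  [/\ (* the gradients exist *)
      [/\ forall x, differentiable Psi x,
          forall x y, differentiable (f ^~ y) x &
          forall x y, differentiable (g ^~ y) x],
      (* (i) *)
      exists2 c : R, 0 < c &
        forall x, c * `|x - xstar| ^+ 2 <= inner (x - xstar) (gradient Psi x),
      (* (ii) *)
      exists a b : nat -> R,
        [/\ nondecreasing_seq a /\ nondecreasing_seq b,
            bounded_fun a /\ bounded_fun b,
            0 < a 0%N /\ 0 < b 0%N &
            forall k x,
              ('E_mu[fun y =>
                  (`|gradient (penalized f g (lambda k) ^~ y) x| ^+ 2)%R]
               < (a k + b k * `|x - xstar| ^+ 2)%:E)%E] &
      (* (iii) *)
      forall r : R, 0 < r -> exists2 kappa : R, 0 < kappa &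
        forall k,
          (ereal_sup
             [set (`|bochner_integral mu (fun y =>
                       (lambda k - lambda_bar) *: gradient (g ^~ y) x)|
                   ^+ 2)%:E | x in [set x : X | `|x| <= r]%R]
           <= (kappa * `|lambda k - lambda_bar| ^+ 2)%:E)%E].
Proof.
have [kQ kQ0 Q_le] := linear_lipschitz Q_bounded.
have [kB kB0 calB_le] := linear_lipschitz calB_bounded.
have [QK _ /linear_lipschitz[kS kS0 Qinv_le]] := Q_inverse.
(* a common bound on the operators and the data *)
pose M := 1 + `|a_max| + kQ + kB + `|u0| + alpha.
have a0 := normr_ge0 a_max; have u00 := normr_ge0 u0.
have M1 : 1 <= M by rewrite /M; lra.
have up (E F : normedModType R) (T : E -> F) (k : R) : k <= M ->
    (forall v, `|T v| <= k * `|v|) -> forall v, `|T v| <= M * `|v|.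
  by move=> kM Tk v; apply: (le_trans (Tk v)); rewrite ler_wpM2r.
have A_leM y : forall v, `|A y v| <= M * `|v|.
  apply: (up _ _ _ `|a_max|) => [|v]; first by rewrite /M; lra.
  apply: (le_trans (opnorm_bound _ (A_bounded y))); rewrite ler_wpM2r//.
  exact: le_trans (A_le y) (ler_norm _).
have calB_leM : forall z, `|calB z| <= M * `|z|.
  by apply: up calB_le; rewrite /M; lra.
have Q_leM : forall v, `|Q v| <= M * `|v| by apply: up Q_le; rewrite /M; lra.
have u0_le : `|u0| <= M by rewrite /M; lra.
have alpha_le : alpha <= M by rewrite /M; lra.
have M0 : 0 <= M := le_trans ler01 M1.
clearbody M.
have QS v : `|v| <= kS * `|Q v| by rewrite -{1}(QK v).
have alpha0 := ltW alpha_gt0.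
have obj_grad y s l (s0 : 0 <= s) (l0 : 0 <= l) x := objective_gradient (B y)
  M1 (A_leM y) calB_leM Q_leM u0_le alpha0 alpha_le x s0 l0.
have obj_grad_le y s l (s0 : 0 <= s) (l0 : 0 <= l) x := objective_gradient_le (B y)
  M1 (A_leM y) calB_leM Q_leM u0_le alpha0 alpha_le x s0 l0.
have PsiE : Psi = fun x => \int[mu]_y
  objective (B y) (A y) calB Q u0 alpha 1 lambda_bar x.
  exact: expected_penalizedE.
have obj_int x : mu.-integrable setT (EFin \o (fun y =>
    objective (B y) (A y) calB Q u0 alpha 1 lambda_bar x)).
  apply: eq_integrable_real (Psi_integrable x) => y.
  by rewrite -penalized_objective.
have hs1_int := integrable_hs1 gram_integrable.
have hs1_sqr_int : mu.-integrable setT (EFin \o fun y => (1 + hs_sqr (B y)) ^+ 2).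
  apply: (integrable_hs1_sqr gram_integrable M1 A_leM calB_leM Q_leM u0_le
    alpha_gt0 alpha_le kS0 QS (ltW (lambda_gt0 0%N))) => x.
  apply: eq_integrable_real (grad_sqr_integrable 0%N x) => y.
  by rewrite penalized_objective.
(* a bound on all penalty parameters *)
pose L := lambda_bar + `|lambda 0%N - lambda_bar|.
have lambda_le k : lambda k <= L.
  have := lambda_mono 0%N k (leq0n k); rewrite ler_pXn2r ?nnegrE//.
  by rewrite -lerBlDl => /(le_trans (ler_norm _)).
have L0 : 0 <= L by rewrite addr_ge0// ltW.
clearbody L.
split.
- split.
  + move=> x; rewrite PsiE.
    exact: (Psi_gradient gram_integrable M1 A_leM calB_leM Q_leM u0_le
      alpha_gt0 alpha_le lambda_bar_gt0 obj_int x).1.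
  + move=> x y; rewrite (cost_objective A B calB).
    exact: (obj_grad y 1 0 ler01 (lexx 0) x).1.
  + move=> x y; rewrite (residual_objective A B calB Q u0 alpha).
    exact: (obj_grad y 0 1 (lexx 0) ler01 x).1.
- rewrite PsiE; rewrite PsiE in xstar_argmin.
  exact: (Psi_strongly_monotone gram_integrable M1 A_leM calB_leM Q_leM u0_le
    alpha_gt0 alpha_le kS0 QS lambda_bar_gt0 obj_int sigma_min_gt0 xstar_argmin).
- pose P := (4 * M ^+ 2 * (1 + L)) ^+ 2 * \int[mu]_y ((1 + hs_sqr (B y)) ^+ 2).
  have P0 : 0 <= P.
    by rewrite mulr_ge0 ?sqr_ge0// Rintegral_ge0// => y _; exact: sqr_ge0.
  exists (fun=> 2 * P * (1 + `|xstar|) ^+ 2 + 1), (fun=> 2 * P + 1).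
  have bounded_cst (c : R) : bounded_fun (fun=> c : R).
    by exists `|c|; split=> // x cx n _; exact: ltW.
  split.
  + by split=> m n _; exact: lexx.
  + by split; exact: bounded_cst.
  + split; last by rewrite /= ltr_wpDl// mulr_ge0.
    by rewrite /= ltr_wpDl// mulr_ge0 ?sqr_ge0// mulr_ge0.
  move=> k x; rewrite expectation.unlock; apply: (@le_lt_trans _ _
    (\int[mu]_y ((4 * M ^+ 2 * (1 + L) * (1 + `|x|)) ^+ 2
      * (1 + hs_sqr (B y)) ^+ 2)%:E)%E).
    apply: ge0_le_integralT => y; rewrite lee_fin ?sqr_ge0//.
    rewrite penalized_objective -exprMn ler_pXn2r ?nnegrE//; last first.
      by rewrite !mulr_ge0 ?addr_ge0 ?sqr_ge0 ?hs_sqr_ge0.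
    apply: (le_trans (obj_grad_le y 1 (lambda k) ler01 (ltW (lambda_gt0 k)) x)).
    rewrite [leRHS]mulrAC ler_wpM2r ?addr_ge0// ler_wpM2r ?addr_ge0 ?hs_sqr_ge0//.
    by rewrite ler_wpM2l ?mulr_ge0 ?sqr_ge0// lerD2l.
  rewrite (integral_realE (integrable_realZ _ hs1_sqr_int)) lte_fin.
  rewrite (RintegralZl _ measurableT hs1_sqr_int) exprMn mulrAC -/P.
  have x_le : 1 + `|x| <= (1 + `|xstar|) + `|x - xstar|.
    by have := ler_normD xstar (x - xstar); rewrite subrKC; lra.
  have x_sqr : (1 + `|x|) ^+ 2 <= 2 * ((1 + `|xstar|) ^+ 2 + `|x - xstar| ^+ 2).
    apply: le_trans (sqrrD_le2 _ _).
    by rewrite ler_pXn2r ?nnegrE ?addr_ge0.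
  have := ler_wpM2l P0 x_sqr; have := sqr_ge0 `|x - xstar|.
  by move: (`|x - xstar| ^+ 2) ((1 + `|x|) ^+ 2) => p q; lra.
- move=> r r0; pose N := 4 * M ^+ 2 * (1 + r) * \int[mu]_y (1 + hs_sqr (B y)).
  (* the summand 1 only ensures positivity *)
  exists (N ^+ 2 + 1); first by rewrite ltr_wpDl ?sqr_ge0.
  move=> k; apply: ge_ereal_sup => _ [x /= xr <-]; rewrite lee_fin.
  pose c := `|lambda k - lambda_bar| * (4 * M ^+ 2 * (1 + r)).
  have K_int : mu.-integrable setT (EFin \o fun y => c * (1 + hs_sqr (B y))).
    exact: integrable_realZ hs1_int.
  have := bochner_integral_norm_le (grad_g_integrable k x) K_int.
  rewrite (integral_realE K_int) (RintegralZl _ measurableT hs1_int) lee_fin.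
  have -> : c * \int[mu]_y (1 + hs_sqr (B y)) = `|lambda k - lambda_bar| * N.
    by rewrite /c /N -mulrA.
  move=> bound; apply: (@le_trans _ _ ((`|lambda k - lambda_bar| * N) ^+ 2)).
    have {}bound : `|bochner_integral mu (fun y =>
        (lambda k - lambda_bar) *: gradient (g ^~ y) x)| <=
        `|lambda k - lambda_bar| * N.
      apply: bound => y; rewrite normrZ (residual_objective A B calB Q u0 alpha).
      rewrite /c -mulrA ler_wpM2l//.
      apply: (le_trans (obj_grad_le y 0 1 (lexx 0) ler01 x)).
      rewrite add0r mulr1 mulrAC ler_wpM2r ?addr_ge0 ?hs_sqr_ge0//.
      by rewrite ler_wpM2l ?mulr_ge0 ?sqr_ge0// lerD2l.
    by rewrite ler_pXn2r ?nnegrE// (le_trans (normr_ge0 _) bound).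
  by rewrite exprMn mulrC ler_wpM2r ?sqr_ge0// lerDl.
Qed.
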